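(* For a positive integer $n$ let $A_n$ be the $n\times n$ matrix with entries $(A_n)_{ij}=(j-i)^2$, let $f(n)=\frac16 n(n-1)(n+1)$, and let $B_n := A_n+f(n)I_n$. Then: (1) $B_n$ has an integer completely positive factorization for every $n\le 5$. (2) $B_6$ does not have an integer completely positive factorization. (3) $B_6+I_6$ has an integer completely positive factorization.
   Context: A real symmetric $n\times n$ matrix $A$ has an integer completely positive factorization if $A=BB^T$ for some $n\times k$ matrix $B$ (for some $k$) all of whose entries are non-negative integers. $I_n$ is the $n\times n$ identity matrix. *)

(* Defs.v *)
From HB Require Import structures.
From mathcomp Require Import all_boot all_order all_algebra.
From mathcomp Require Import reals.

Set Implicit Arguments.
Unset Strict Implicit.
Unset Printing Implicit Defensive.

Import Order.TTheory GRing.Theory Num.Theory.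
Local Open Scope ring_scope.

(* Symmetry of A is not assumed separately: it follows from A = B *m B^T.
   Num.nat is the set of elements of R of the form m%:R with m : nat. *)
Definition integer_cp_factorization (R : realType) (n : nat) (A : 'M[R]_n)
    : Prop :=
  exists (k : nat) (B : 'M[R]_(n, k)),
    (forall i j, B i j \is a Num.nat) /\ A = B *m B^T.

(* Indices run over 0, ..., n-1 rather than 1, ..., n; the entries depend only
   on the difference j - i, which is computed in R and not truncated. *)
Definition distsq_mx (R : realType) (n : nat) : 'M[R]_n :=
  \matrix_(i < n, j < n) ((j : nat)%:R - (i : nat)%:R) ^+ 2.

Definition fshift (R : realType) (n : nat) : R :=
  6%:R^-1 * n%:R * (n%:R - 1) * (n%:R + 1).

Definition shifted_distsq_mx (R : realType) (n : nat) : 'M[R]_n :=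
  distsq_mx R n + fshift R n *: 1%:M.

(* Main.v *)
Require Import Defs.
From HB Require Import structures.
From mathcomp Require Import all_boot all_order all_algebra.
From mathcomp Require Import reals.
From mathcomp Require Import zify ring.

Set Implicit Arguments.
Unset Strict Implicit.
Unset Printing Implicit Defensive.

Import Order.TTheory GRing.Theory Num.Theory.
Local Open Scope ring_scope.

(** An integer completely positive factorization is a finite list of vectors of
natural numbers, the columns of the factor, whose Gram matrix is the given one
([integer_cp_factorizationP]). The positive claims are therefore settled by
exhibiting columns and adding up products.

For the negative claim, the shift is chosen so that the matrix B_6 is singular:
the vector x = (-5, -3, -1, 1, 3, 5) satisfies x^T B_6 x = 0. As this number is
the sum over the columns v of the squares of x . v, every column is orthogonal
to x ([kernel_eq]). Moreover a product of two entries of one column never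
exceeds the corresponding entry of B_6, since all contributions to that entry
are nonnegative. Write a column as (p, q, r, s, t, u). These two constraints
leave only twelve possible columns with r > 0 ([third_row_columnsP]), and in
them r is 1, 3 or 5. Let X, Y and Z be the numbers of columns with r = 5, 3
and 1.

The diagonal entry 35 gives 25 X + 9 Y + Z = 35, and because every column
satisfies 3 [r = 3] + [r = 1] <= r s + r t, the entries 1 and 4 give
3 Y + Z <= 5. The only solution in natural numbers is X = Y = Z = 1.
Finally each of the possible columns satisfies
  r p + 4 r t + 9 r s <= 3 t u + 13 [r = 1] + 12 [r = 3],
whose sum over all columns reads 4 + 16 + 9 <= 3 + 13 + 12, that is 29 <= 28
([no_factorization6]). Integrality is used in solving for X, Y, Z and in
limiting the possible columns. *)

(** * Factorizations as lists of natural columns *)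

Definition gram (s : seq (seq nat)) (i j : nat) : nat :=
  (\sum_(v <- s) nth 0 v i * nth 0 v j)%N.

Lemma gram_ge (s : seq (seq nat)) (v : seq nat) (i j : nat) :
  v \in s -> (nth 0 v i * nth 0 v j <= gram s i j)%N.
Proof. by move=> vs; rewrite /gram (big_rem v) //= leq_addr. Qed.

(** Removes the ordered field from the problem: what is left is a statement
about natural numbers, and the number of columns is no longer a dimension. *)
Lemma integer_cp_factorizationP (R : realType) (n : nat) (a : nat -> nat -> nat)
    (A : 'M[R]_n) : (forall i j, A i j = (a i j)%:R) ->
  integer_cp_factorization A <->
  exists s : seq (seq nat), forall i j : 'I_n, gram s i j = a i j.
Proof.
move=> Aa; split=> [[k [B [Bnat AB]]]|[s sa]].
  exists [seq [seq Num.truncn (B i c) | i : 'I_n] | c : 'I_k] => i j.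
  apply/eqP; rewrite -(eqr_nat R) -Aa AB mxE; apply/eqP.
  rewrite /gram big_image natr_sum /=; apply: eq_bigr => c _.
  have entry (l : 'I_n) : nth 0%N [seq Num.truncn (B i c) | i : 'I_n] l
      = Num.truncn (B l c) by rewrite (nth_map l) ?size_enum_ord // nth_ord_enum.
  by rewrite !entry natrM !truncnK ?Bnat // mxE.
exists (size s), (\matrix_(i, c) (nth 0%N (nth [::] s c) i)%:R).
split=> [i c|]; first by rewrite mxE.
apply/matrixP => i j; rewrite Aa -sa !mxE /gram (big_nth [::]) big_mkord natr_sum.
by apply: eq_bigr => c _; rewrite !mxE natrM.
Qed.

(** At most one of the two truncated differences is nonzero, so the sum of
their squares is the square of the distance between [i] and [j]. *)
Definition shifted_distsq (n i j : nat) : nat :=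
  ((i - j) ^ 2 + (j - i) ^ 2 + (i == j) * 'C(n.+1, 3))%N.

Lemma fshiftE (R : realType) (n : nat) : fshift R n = 'C(n.+1, 3)%:R.
Proof.
have six : 6%:R != 0 :> R by rewrite pnatr_eq0.
apply: (mulIf six); rewrite -natrM (_ : 6 = 3`!)%N // bin_ffact /fshift.
case: n => [|n]; first by rewrite mulr0 !mul0r.
rewrite !ffactnSr ffactn0 mul1n subn0 subn1 subn2 /= !natrM.
by rewrite -(natr1 n.+1) -(natr1 n); field.
Qed.

Lemma shifted_distsq_mxE (R : realType) (n : nat) (i j : 'I_n) :
  shifted_distsq_mx R n i j = (shifted_distsq n i j)%:R.
Proof.
rewrite !mxE fshiftE /shifted_distsq natrD mulnC natrM; congr (_ + _ * _%:R).
have [ij|/ltnW ij] := leqP i j.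
  by rewrite (eqP (ij : i - j == 0)%N) add0n natrX natrB.
by rewrite (eqP (ij : j - i == 0)%N) addn0 natrX natrB // -sqrrN opprB.
Qed.

(** * Checking explicit factorizations *)

(** The sum of [gram] is spelled out with [foldr] because big operators do not
evaluate. *)
Definition gram_check (n m : nat) (s : seq (seq nat)) : bool :=
  all (fun i => all (fun j =>
    (foldr addn 0 [seq nth 0 v i * nth 0 v j | v <- s]
      == shifted_distsq n i j + (i == j) * m)%N)
    (iota 0 n)) (iota 0 n).

Lemma gram_checkP (n m : nat) (s : seq (seq nat)) : gram_check n m s ->
  forall i j : 'I_n, gram s i j = (shifted_distsq n i j + (i == j) * m)%N.
Proof.
move=> ok i j.
have mem (l : 'I_n) : (l : nat) \in iota 0 n by rewrite mem_iota /=.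
have /eqP <- := allP (allP ok _ (mem i)) _ (mem j).
by rewrite -[foldr _ _ _]/(sumn _) sumnE big_map.
Qed.

Lemma gram_check_factorization (R : realType) (n m : nat) (s : seq (seq nat)) :
  gram_check n m s ->
  integer_cp_factorization (shifted_distsq_mx R n + m%:R%:M).
Proof.
move=> /gram_checkP sn.
apply/(integer_cp_factorizationP
  (a := fun i j => shifted_distsq n i j + (i == j) * m)%N); last by exists s.
by move=> i j; rewrite mxE shifted_distsq_mxE !mxE natrD [in RHS]mulnC mulrnA.
Qed.

(** * The columns of a factorization for n = 6 *)

Lemma sum_sq_linear (s : seq (seq nat)) (n : nat) (x : nat -> int) :
  \sum_(v <- s) (\sum_(0 <= i < n) x i * (nth 0%N v i)%:Z) ^+ 2 =
  \sum_(0 <= i < n) \sum_(0 <= j < n) x i * x j * (gram s i j)%:Z.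
Proof.
transitivity (\sum_(v <- s) \sum_(0 <= i < n) \sum_(0 <= j < n)
    x i * x j * (nth 0 v i * nth 0 v j)%N%:Z).
  apply: eq_bigr => v _; rewrite expr2 mulr_suml; apply: eq_bigr => i _.
  by rewrite mulr_sumr; apply: eq_bigr => j _; rewrite PoszM; ring.
rewrite exchange_big; apply: eq_bigr => i _ /=.
rewrite exchange_big; apply: eq_bigr => j _ /=.
rewrite -mulr_sumr /gram -natz natr_sum; congr (_ * _).
by apply: eq_bigr => v _; rewrite natz.
Qed.

(** The coordinates of the positions 0, ..., 5 relative to their mean, doubled,
form a kernel vector of the matrix; a sum of squares equal to 0 then makes every
column orthogonal to it. The negative terms are moved to the other side. *)
Lemma kernel_eq (s : seq (seq nat)) (v : seq nat) :
    (forall i j : 'I_6, gram s i j = shifted_distsq 6 i j) -> v \in s ->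
  (5 * nth 0 v 5 + 3 * nth 0 v 4 + nth 0 v 3
    = 5 * nth 0 v 0 + 3 * nth 0 v 1 + nth 0 v 2)%N.
Proof.
move=> gs vs; pose x i : int := 2 * i%:Z - 5.
have /eqP : \sum_(v <- s) (\sum_(0 <= i < 6) x i * (nth 0%N v i)%:Z) ^+ 2 = 0.
  rewrite sum_sq_linear.
  transitivity (\sum_(0 <= i < 6) \sum_(0 <= j < 6)
      x i * x j * (shifted_distsq 6 i j)%:Z).
    rewrite !big_mkord; apply: eq_bigr => i _; rewrite !big_mkord.
    by apply: eq_bigr => j _; rewrite gs.
  by rewrite !big_nat_recl // !big_geq.
rewrite psumr_eq0 => [/allP/(_ v vs)|w _]; last exact: sqr_ge0.
by rewrite /= sqrf_eq0 !big_nat_recl // big_geq // /x => /eqP; lia.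
Qed.

Definition third_row_columns : seq (seq nat) :=
  [:: [:: 0; 0; 5; 0; 0; 1]; [:: 0; 0; 3; 0; 1; 0]; [:: 1; 0; 3; 0; 1; 1];
      [:: 0; 0; 1; 1; 0; 0]; [:: 1; 0; 1; 1; 0; 1]; [:: 2; 0; 1; 1; 0; 2];
      [:: 3; 0; 1; 1; 0; 3]; [:: 4; 0; 1; 1; 0; 4]; [:: 0; 1; 1; 1; 1; 0];
      [:: 1; 1; 1; 1; 1; 1]; [:: 1; 0; 1; 0; 2; 0]; [:: 1; 1; 1; 0; 3; 0]]%N.

(** Since [r] is positive, the bounds on its products with the other entries
confine the column to a finite box, which is searched exhaustively. *)
Lemma third_row_columnsP (p q r s t u : nat) : (0 < r)%N ->
    (p * r <= 4 -> q * r <= 1 -> r * r <= 35 -> r * s <= 1 -> r * t <= 4 ->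
     r * u <= 9 -> p * q <= 1 -> s * t <= 1 -> t * u <= 1 ->
     5 * u + 3 * t + s = 5 * p + 3 * q + r ->
  [:: p; q; r; s; t; u] \in third_row_columns)%N.
Proof.
move=> r0 pr qr rr rs rt ru pq st tu ker.
have box : (all (fun p => all (fun q => all (fun r => all (fun s => all (fun t =>
    all (fun u => [&& p * r <= 4, q * r <= 1, r * s <= 1, r * t <= 4,
      p * q <= 1, s * t <= 1, t * u <= 1 & 5 * u + 3 * t + s == 5 * p + 3 * q + r]
      ==> ([:: p; q; r; s; t; u] \in third_row_columns))
    (iota 0 10)) (iota 0 5)) (iota 0 2)) (iota 1 5)) (iota 0 2)) (iota 0 5))%N.
  by vm_compute.
have [mp mq mr] : [/\ p \in iota 0 5, q \in iota 0 2 & r \in iota 1 5].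
  by rewrite !mem_iota; split; nia.
have [ms mt mu] : [/\ s \in iota 0 2, t \in iota 0 5 & u \in iota 0 10].
  by rewrite !mem_iota; split; nia.
move: box => /allP/(_ p mp)/allP/(_ q mq)/allP/(_ r mr).
move=> /allP/(_ s ms)/allP/(_ t mt)/allP/(_ u mu).
by rewrite pr qr rs rt pq st tu ker eqxx.
Qed.

(** The last inequality is a linear programming certificate. Once there is
exactly one column with [r = 1] and one with [r = 3], the two have [t = 1] and
must supply [\sum r * p = 4] together, which forces [p = u = 1] in both and
makes [\sum t * u] at least 2. The coefficients 4, 9, 3, 13 and 12 condense this
reasoning into one inequality, valid for every column, that the entries of the
matrix violate by 1. *)
Lemma third_row_bounds (p q r s t u : nat) :
    ((0 < r)%N -> [:: p; q; r; s; t; u] \in third_row_columns) ->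
  [/\ r * r = 25 * (r == 5) + 9 * (r == 3) + (r == 1),
      3 * (r == 3) + (r == 1) <= r * s + r * t
    & r * p + 4 * (r * t) + 9 * (r * s) <=
      3 * (t * u) + 13 * (r == 1) + 12 * (r == 3)]%N.
Proof.
case: r => [_|r /(_ isT)]; first by split; rewrite ?mul0n.
rewrite !inE => /orP.
do 10![case=> [/eqP [-> _ -> -> -> ->] //|/orP]].
by case=> /eqP [-> _ -> -> -> ->].
Qed.

Lemma no_factorization6 (s : seq (seq nat)) :
  ~ (forall i j : 'I_6, gram s i j = shifted_distsq 6 i j).
Proof.
move=> gs.
have ent i j : (i < 6)%N -> (j < 6)%N -> gram s i j = shifted_distsq 6 i j.
  by move=> i6 j6; exact: (gs (Ordinal i6) (Ordinal j6)).
have row v : v \in s -> let e := nth 0%N v in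
    [/\ e 2 * e 2 = 25 * (e 2 == 5) + 9 * (e 2 == 3) + (e 2 == 1),
        3 * (e 2 == 3) + (e 2 == 1) <= e 2 * e 3 + e 2 * e 4
      & e 2 * e 0 + 4 * (e 2 * e 4) + 9 * (e 2 * e 3) <=
        3 * (e 4 * e 5) + 13 * (e 2 == 1) + 12 * (e 2 == 3)]%N.
  move=> vs; have le i j : (i < 6)%N -> (j < 6)%N ->
      (nth 0 v i * nth 0 v j <= shifted_distsq 6 i j)%N.
    by move=> i6 j6; rewrite -ent // gram_ge.
  apply: third_row_bounds => r0.
  by apply: (third_row_columnsP r0); [exact: (le 0 2)%N | exact: (le 1 2)%N
    | exact: (le 2 2)%N | exact: (le 2 3)%N | exact: (le 2 4)%N
    | exact: (le 2 5)%N | exact: (le 0 1)%N | exact: (le 3 4)%N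
    | exact: (le 4 5)%N | exact: kernel_eq gs vs].
pose N k := (\sum_(v <- s) (nth 0 v 2 == k))%N.
have sq : (gram s 2 2 = 25 * N 5 + 9 * N 3 + N 1)%N.
  rewrite /gram /N !big_distrr -!big_split /=.
  by apply: eq_big_seq => v /row [].
have few : (3 * N 3 + N 1 <= gram s 2 3 + gram s 2 4)%N.
  rewrite /gram /N !big_distrr -!big_split /= big_seq [leqRHS]big_seq.
  by apply: leq_sum => v /row [].
have cert : (gram s 2 0 + 4 * gram s 2 4 + 9 * gram s 2 3
    <= 3 * gram s 4 5 + 13 * N 1 + 12 * N 3)%N.
  rewrite /gram /N !big_distrr -!big_split /= big_seq [leqRHS]big_seq.
  by apply: leq_sum => v /row [].
move: sq few cert; rewrite !ent //.
rewrite (_ : shifted_distsq 6 2 2 = 35)%N // (_ : shifted_distsq 6 2 3 = 1)%N //.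
rewrite (_ : shifted_distsq 6 2 4 = 4)%N // (_ : shifted_distsq 6 2 0 = 4)%N //.
by rewrite (_ : shifted_distsq 6 4 5 = 1)%N //; lia.
Qed.

(** * Explicit factorizations and the conclusion *)

Lemma small_factorizations (R : realType) (n : nat) : (0 < n <= 5)%N ->
  integer_cp_factorization (shifted_distsq_mx R n).
Proof.
move=> n5; suff [s sn] : exists s, gram_check n 0 s.
  have := gram_check_factorization R sn.
  by rewrite (_ : 0%:R%:M = 0) ?addr0 //; exact: raddf0.
case: n n5 => [|[|[|[|[|[|n]]]]]] // _.
- by exists [::].
- by exists [:: [:: 1; 1]]%N.
- exists (nseq 3 [:: 1; 0; 1] ++ nseq 3 [:: 0; 1; 0] ++ [:: [:: 1; 1; 1]])%N.
  by vm_compute.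
- exists (nseq 2 [:: 2; 0; 0; 2] ++
    [:: [:: 1; 0; 3; 0]; [:: 0; 3; 0; 1]; [:: 1; 1; 1; 1]])%N.
  by vm_compute.
- exists (nseq 2 [:: 1; 0; 0; 0; 1] ++ nseq 3 [:: 0; 1; 0; 1; 0] ++
    nseq 2 [:: 0; 0; 1; 0; 0] ++
    [:: [:: 2; 0; 0; 0; 2]; [:: 3; 0; 1; 0; 3]; [:: 2; 0; 0; 4; 0];
        [:: 0; 4; 0; 0; 2]; [:: 0; 0; 4; 0; 0]; [:: 1; 1; 1; 1; 1]])%N.
  by vm_compute.
Qed.

(** The extra identity matrix makes the matrix nonsingular, so the columns need
no longer be orthogonal to the former kernel vector: [[:: 0; 0; 2; 0; 0; 0]] is
now possible, for example. *)
Lemma factorization6_succ (R : realType) :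
  integer_cp_factorization (shifted_distsq_mx R 6 + 1%:M).
Proof.
pose s : seq (seq nat) :=
  (nseq 2 [:: 1; 0; 0; 0; 0; 1] ++ nseq 2 [:: 0; 0; 2; 0; 0; 0] ++
  [:: [:: 4; 0; 0; 0; 0; 4]; [:: 2; 0; 1; 0; 0; 2]; [:: 2; 0; 1; 1; 1; 1];
      [:: 0; 1; 1; 0; 0; 2]; [:: 1; 1; 0; 2; 0; 1]; [:: 0; 0; 3; 0; 1; 0];
      [:: 0; 2; 0; 1; 0; 1]; [:: 1; 0; 0; 5; 0; 0]; [:: 0; 0; 4; 0; 0; 1];
      [:: 2; 0; 0; 0; 4; 0]; [:: 0; 4; 0; 0; 0; 2]; [:: 2; 0; 0; 0; 3; 0];
      [:: 0; 2; 0; 0; 0; 1]; [:: 0; 3; 0; 0; 3; 0]; [:: 0; 0; 0; 2; 0; 0];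
      [:: 0; 1; 0; 0; 0; 1]; [:: 0; 0; 0; 1; 0; 0]])%N.
have s6 : gram_check 6 1 s by vm_compute.
by have := gram_check_factorization R s6; rewrite mulr1n.
Qed.

Theorem proposition10 (R : realType) :
  [/\ (forall n : nat, (0 < n <= 5)%N ->
         integer_cp_factorization (shifted_distsq_mx R n)),
      ~ integer_cp_factorization (shifted_distsq_mx R 6)
    & integer_cp_factorization (shifted_distsq_mx R 6 + 1%:M)].
Proof.
split; [exact: small_factorizations | | exact: factorization6_succ].
by case/(integer_cp_factorizationP (@shifted_distsq_mxE R 6)) => s /no_factorization6.
Qed.
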